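(* Let $(X,\omega)$ be a compact connected K\''ahler manifold of complex dimension $n\ge 3$, and let $L$ be a holomorphic line bundle over $X$ with $\hat\theta\ge 0$ satisfying the supercritical phase condition $\hat\theta>(n-2)\frac\pi2$. If there exists a metric on $L$ solving $\theta\equiv\hat\theta$, then $L$ is stable, i.e. there exists a metric $h$ on $L$, with curvature $F$, such that the real $(1,1)$-form $$\Omega:=-\tan\Big(\hat\theta-(n-1)\frac\pi2\Big)\,\omega+iF$$ is positive definite.
   Context: A metric on $L$ means a smooth Hermitian metric. Locally $\omega=\frac i2 g_{\bar kj}\,dz^j\wedge d\bar z^k$, normalized so that $\int_X\frac{\omega^n}{n!}=1$. The curvature of a metric $h$ on $L$ is $F=F(h)=\frac12F_{\bar kj}\,dz^j\wedge d\bar z^k$ with $F_{\bar kj}=-\partial_j\partial_{\bar k}\log h$, so $iF$ is a real closed $(1,1)$-form. Let $\lambda_1,\dots,\lambda_n$ be the (real) eigenvalues of the endomorphism $K^j{}_\ell=g^{j\bar k}F_{\bar k\ell}$ of $T^{1,0}X$, and put $\theta=\theta(h)=\sum_j\arctan\lambda_j$, a real function on $X$ which is an argument of $\frac{(\omega-F)^n}{\omega^n}$. The number $Z_L:=\int_X\frac{(\omega-F)^n}{n!}$ is independent of the metric and assumed nonzero, and $\hat\theta\in\mathbb R$ denotes an argument of $Z_L$; the equation $\theta\equiv\hat\theta$ is the paper's equivalent form of the deformed Hermitian-Yang-Mills equation $\mathrm{Im}(\omega-F)^n=\tan\hat\theta\,\mathrm{Re}(\omega-F)^n$. *)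

(* Defs.v *)
From HB Require Import structures.
From mathcomp Require Import all_boot all_order all_algebra.
From mathcomp Require Import spectral sesquilinear complex.
From mathcomp Require Import all_classical all_reals all_analysis.

Set Implicit Arguments.
Unset Strict Implicit.
Unset Printing Implicit Defensive.

Import Order.TTheory GRing.Theory Num.Theory.
Import numFieldNormedType.Exports.
Local Open Scope classical_set_scope.
Local Open Scope complex_scope.
Local Open Scope sesquilinear_scope.
Local Open Scope ring_scope.

(* The coordinate space C^n is represented by its underlying real normed
   space: a point z = x + i y is the pair (x, y), so that real partial
   derivatives, hence Wirtinger derivatives, are available. *)
Definition coordSpace (R : realType) (n : nat) : normedModType R :=
  ('rV[R]_n * 'rV[R]_n)%type.

Definition zcoord (R : realType) (n : nat) (j : 'I_n)
  (p : coordSpace R n) : R[i] := p.1 ord0 j +i* p.2 ord0 j.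

(* [inl j] is the direction of x_j, [inr j] the direction of y_j. *)
Definition realDir (R : realType) (n : nat) (d : 'I_n + 'I_n) :
    coordSpace R n :=
  match d with
  | inl j => (delta_mx ord0 j, 0)
  | inr j => (0, delta_mx ord0 j)
  end.

Definition partial (R : realType) (n : nat) (d : 'I_n + 'I_n)
    (f : coordSpace R n -> R) (p : coordSpace R n) : R :=
  'D_(realDir R d) f p.

Definition iterPartial (R : realType) (n : nat) (s : seq ('I_n + 'I_n))
    (f : coordSpace R n -> R) : coordSpace R n -> R :=
  foldr (@partial R n) f s.

(* C^oo on the open set U *)
Definition smoothOn (R : realType) (n : nat) (U : set (coordSpace R n))
    (f : coordSpace R n -> R) : Prop :=
  forall (s : seq ('I_n + 'I_n)) (p : coordSpace R n), U p ->
    {for p, continuous (iterPartial s f)} /\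
    forall d, derivable (iterPartial s f) p (realDir R d).

Definition csmoothOn (R : realType) (n : nat) (U : set (coordSpace R n))
    (f : coordSpace R n -> R[i]) : Prop :=
  smoothOn U (fun p => complex.Re (f p)) /\
  smoothOn U (fun p => complex.Im (f p)).

Definition cpartial (R : realType) (n : nat) (d : 'I_n + 'I_n)
    (f : coordSpace R n -> R[i]) (p : coordSpace R n) : R[i] :=
  partial d (fun q => complex.Re (f q)) p +i*
  partial d (fun q => complex.Im (f q)) p.

(* Wirtinger derivatives d/dz_j = (d/dx_j - i d/dy_j) / 2 and
   d/dzbar_j = (d/dx_j + i d/dy_j) / 2 *)
Definition dz (R : realType) (n : nat) (j : 'I_n)
    (f : coordSpace R n -> R[i]) (p : coordSpace R n) : R[i] :=
  (cpartial (inl j) f p - 'i * cpartial (inr j) f p) / 2.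

Definition dzbar (R : realType) (n : nat) (j : 'I_n)
    (f : coordSpace R n -> R[i]) (p : coordSpace R n) : R[i] :=
  (cpartial (inl j) f p + 'i * cpartial (inr j) f p) / 2.

Definition holomorphicOn (R : realType) (n : nat) (U : set (coordSpace R n))
    (f : coordSpace R n -> R[i]) : Prop :=
  csmoothOn U f /\ forall p, U p -> forall k, dzbar k f p = 0.

(* [chart a] is a homeomorphism from the open set [chartDom a] of X onto the
   open set [chartImg a] of C^n with inverse [param a]; both maps are total
   functions whose values outside these sets are irrelevant. *)
Record complexManifold (R : realType) (n : nat) := ComplexManifold {
  carrier :> topologicalType;
  chartIdx : Type;
  chartDom : chartIdx -> set carrier;
  chartImg : chartIdx -> set (coordSpace R n);
  chart : chartIdx -> carrier -> coordSpace R n;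
  param : chartIdx -> coordSpace R n -> carrier;
  manifold_hausdorff : hausdorff_space carrier;
  manifold_second_countable : @second_countable carrier;
  chart_cover : forall x, exists a, chartDom a x;
  chartDom_open : forall a, open (chartDom a);
  chartImg_open : forall a, open (chartImg a);
  chart_in : forall a x, chartDom a x -> chartImg a (chart a x);
  param_in : forall a p, chartImg a p -> chartDom a (param a p);
  chartK : forall a x, chartDom a x -> param a (chart a x) = x;
  paramK : forall a p, chartImg a p -> chart a (param a p) = p;
  chart_continuous : forall a x,
    chartDom a x -> {for x, continuous (chart a)};
  param_continuous : forall a p,
    chartImg a p -> {for p, continuous (param a)};
  transition_holomorphic : forall a b j,
    holomorphicOn [set p | chartImg a p /\ chartDom b (param a p)]
      (fun p => zcoord j (chart b (param a p)))
}.

(* The coefficients, in every chart, of a (1,1)-form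
   (i/2) \sum_(j, k) A_{kbar j} dz^j /\ dzbar^k; the entry of A in row k and
   column j is A_{kbar j}. *)
Definition coeffs11 (R : realType) (n : nat) (X : complexManifold R n) :=
  chartIdx X -> coordSpace R n -> 'M[R[i]]_n.

Definition posdefmx (R : realType) (n : nat) (A : 'M[R[i]]_n) : Prop :=
  A \is hermsymmx /\
  forall v : 'cV[R[i]]_n, v != 0 -> 0 < (v ^t* *m A *m v) ord0 ord0.

Definition positive11 (R : realType) (n : nat) (X : complexManifold R n)
    (A : coeffs11 X) : Prop :=
  forall a p, chartImg a p -> posdefmx (A a p).

(* entry (m, l): derivative of the m-th coordinate of chart b with respect to
   the l-th coordinate of chart a *)
Definition jacobian (R : realType) (n : nat) (X : complexManifold R n)
    (a b : chartIdx X) (p : coordSpace R n) : 'M[R[i]]_n :=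
  \matrix_(m, l) dz l (fun q => zcoord m (chart b (param a q))) p.

Record kahlerForm (R : realType) (n : nat) (X : complexManifold R n) :=
  KahlerForm {
  kcoeff : coeffs11 X;
  kahler_smooth : forall a k j,
    csmoothOn (chartImg a) (fun p => kcoeff a p k j);
  kahler_transition : forall a b p,
    chartImg a p -> chartDom b (param a p) ->
    kcoeff a p = (jacobian a b p) ^t* *m
                 kcoeff b (chart b (param a p)) *m jacobian a b p;
  kahler_positive : positive11 kcoeff;
  (* the two conditions are the vanishing of the (2,1) and (1,2) parts of the
     exterior derivative *)
  kahler_closed : forall a p, chartImg a p -> forall j k l,
    dz l (fun q => kcoeff a q k j) p = dz j (fun q => kcoeff a q k l) p /\
    dzbar l (fun q => kcoeff a q k j) p = dzbar k (fun q => kcoeff a q l j) p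
}.

(* Iterated integral over R^m; it is applied below only to smooth functions
   with compact support, for which it is the Lebesgue integral. *)
Fixpoint iteratedInt (R : realType) (m : nat) : ('rV[R]_m -> R) -> R :=
  match m with
  | 0 => fun f => f 0
  | m'.+1 => fun f =>
      \int[lebesgue_measure]_(t in [set: R])
        iteratedInt (fun v : 'rV[R]_m' =>
                       f (row_mx (t%:M : 'rV[R]_1) v : 'rV[R]_(1 + m')))
  end.

Definition coordInt (R : realType) (n : nat) (f : coordSpace R n -> R) : R :=
  iteratedInt (fun x : 'rV[R]_n => iteratedInt (fun y : 'rV[R]_n => f (x, y))).

Definition ccoordInt (R : realType) (n : nat)
    (f : coordSpace R n -> R[i]) : R[i] :=
  coordInt (fun p => complex.Re (f p)) +i* coordInt (fun p => complex.Im (f p)).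

Record partitionOfUnity (R : realType) (n : nat) (X : complexManifold R n) :=
  PartitionOfUnity {
  puSize : nat;
  puChart : 'I_puSize -> chartIdx X;
  puFun : 'I_puSize -> X -> R;
  pu_ge0 : forall i x, 0 <= puFun i x;
  pu_sum : forall x, \sum_i puFun i x = 1;
  pu_smooth : forall i a,
    smoothOn (chartImg a) (fun p => puFun i (param a p));
  pu_support : forall i,
    closure [set x | puFun i x != 0] `<=` chartDom (puChart i)
}.
Arguments puChart {R n X} _ _.
Arguments puFun {R n X} _ _ _.

(* Integral over a compact X of the complex top-degree form which in the
   chart a is d a * dx_1 dy_1 ... dx_n dy_n, computed with a finite smooth
   partition of unity subordinate to the atlas; the value does not depend on
   the partition, so [xget] selects from a singleton. *)
Definition manifoldInt (R : realType) (n : nat) (X : complexManifold R n)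
    (d : chartIdx X -> coordSpace R n -> R[i]) : R[i] :=
  xget 0 [set v | exists P : partitionOfUnity X,
    v = \sum_i ccoordInt (fun p =>
          (\1_(chartImg (puChart P i)) p
             * puFun P i (param (puChart P i) p))%:C * d (puChart P i) p)].

(* For alpha = (i/2) A_{kbar j} dz^j /\ dzbar^k one has, since
   (i/2) dz^j /\ dzbar^j = dx_j /\ dy_j,
     alpha^n / n! = det(A) dx_1 /\ dy_1 /\ ... /\ dx_n /\ dy_n. *)
Definition topPowerInt (R : realType) (n : nat) (X : complexManifold R n)
    (A : coeffs11 X) : R[i] :=
  manifoldInt (fun a p => \det (A a p)).

(* A holomorphic line bundle given by local frames over the open cover
   [trivDom]; the components s_i of a section satisfy s_i = g_ij s_j, where
   g_ij is [cocycle i j]. [trivAt x] is some trivialization around x. *)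
Record lineBundle (R : realType) (n : nat) (X : complexManifold R n) :=
  LineBundle {
  trivIdx : Type;
  trivDom : trivIdx -> set X;
  cocycle : trivIdx -> trivIdx -> X -> R[i];
  trivAt : X -> trivIdx;
  trivAt_in : forall x, trivDom (trivAt x) x;
  trivDom_open : forall i, open (trivDom i);
  cocycle_holomorphic : forall a i j,
    holomorphicOn
      [set p | [/\ chartImg a p, trivDom i (param a p)
                 & trivDom j (param a p)]]
      (fun p => cocycle i j (param a p));
  cocycle_neq0 : forall i j x,
    trivDom i x -> trivDom j x -> cocycle i j x != 0;
  cocycleM : forall i j k x, trivDom i x -> trivDom j x -> trivDom k x ->
    cocycle i j x * cocycle j k x = cocycle i k x
}.

(* The squared length of a section s is [weight i x * |s_i(x)|^2] on
   [trivDom i]. *)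
Record hermitianMetric (R : realType) (n : nat) (X : complexManifold R n)
    (L : lineBundle X) := HermitianMetric {
  weight : trivIdx L -> X -> R;
  weight_gt0 : forall i x, trivDom i x -> 0 < weight i x;
  weight_smooth : forall a i,
    smoothOn [set p | chartImg a p /\ trivDom i (param a p)]
      (fun p => weight i (param a p));
  weight_transition : forall i j x, trivDom i x -> trivDom j x ->
    (weight j x)%:C = `|cocycle i j x| ^+ 2 * (weight i x)%:C
}.

(* The coefficients F_{kbar j} = - d_j d_kbar (log h) of iF as a (1,1)-form
   (i/2) F_{kbar j} dz^j /\ dzbar^k. They do not depend on the trivialization
   used, because log |g_ij|^2 is pluriharmonic. *)
Definition curvature (R : realType) (n : nat) (X : complexManifold R n)
    (L : lineBundle X) (h : hermitianMetric L) : coeffs11 X :=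
  fun a p => \matrix_(k, j)
    - dz j (dzbar k (fun q =>
        (ln (weight h (trivAt L (param a p)) (param a q)))%:C)) p.

(* roots of the characteristic polynomial, with multiplicity *)
Definition eigenvals (R : realType) (n : nat) (K : 'M[R[i]]_n) : seq R[i] :=
  sval (closed_field_poly_normal (char_poly K)).

(* The endomorphism K^j_l = g^{j kbar} F_{kbar l} *)
Definition curvEndo (R : realType) (n : nat) (X : complexManifold R n)
    (w : kahlerForm X) (L : lineBundle X) (h : hermitianMetric L)
    (a : chartIdx X) (p : coordSpace R n) : 'M[R[i]]_n :=
  invmx (kcoeff w a p) *m curvature h a p.

(* The eigenvalues are real, so taking real parts only changes their type. *)
Definition theta (R : realType) (n : nat) (X : complexManifold R n)
    (w : kahlerForm X) (L : lineBundle X) (h : hermitianMetric L)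
    (a : chartIdx X) (p : coordSpace R n) : R :=
  \sum_(lam <- eigenvals (curvEndo w h a p)) atan (complex.Re lam).

(* The integral of (omega - F)^n / n!; as F = (1/2) F_{kbar j} dz^j /\ dzbar^k,
   omega - F has coefficients g_{kbar j} + i F_{kbar j} with respect to
   (i/2) dz^j /\ dzbar^k. *)
Definition chargeZ (R : realType) (n : nat) (X : complexManifold R n)
    (w : kahlerForm X) (L : lineBundle X) (h : hermitianMetric L) : R[i] :=
  topPowerInt (fun a p => kcoeff w a p + 'i *: curvature h a p).

Definition isArg (R : realType) (z : R[i]) (t : R) : Prop :=
  z = `|z| * (cos t +i* sin t).

Definition OmegaForm (R : realType) (n : nat) (X : complexManifold R n)
    (w : kahlerForm X) (L : lineBundle X) (h : hermitianMetric L)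
    (thetahat : R) : coeffs11 X :=
  fun a p => (- tan (thetahat - (n%:R - 1) * (pi / 2)))%:C *: kcoeff w a p
             + curvature h a p.

Definition stable (R : realType) (n : nat) (X : complexManifold R n)
    (w : kahlerForm X) (L : lineBundle X) (thetahat : R) : Prop :=
  exists h : hermitianMetric L, positive11 (OmegaForm w h thetahat).

(* Main.v *)
Require Import Defs.
From mathcomp Require Import all_boot all_order all_algebra.
From mathcomp Require Import complex.
From mathcomp Require Import spectral sesquilinear ring lra.
From mathcomp Require Import all_classical all_reals all_analysis.

(** The metric h that solves theta = thetahat is itself the witness of
    stability, and the reason is pointwise.

    At a point, let g be the matrix of omega and F that of iF. As g is positive
    definite and F is Hermitian, there is an invertible T with g = T^* T and
    F = T^* D T for a real diagonal D ([simultaneous_diag]), so the entries of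
    D are eigenvalues of g^-1 F, and c g + F = T^* (c + D) T is positive
    definite as soon as each eigenvalue lambda satisfies c + lambda > 0
    ([posdef_shift]). Here c = - tan (thetahat - (n - 1) pi / 2). From
    sum_j arctan lambda_j = thetahat and arctan < pi / 2, each arctan lambda_j
    exceeds thetahat - (n - 1) pi / 2; the supercritical phase condition puts
    this number above - pi / 2, where tan is increasing up to pi / 2, and so
    lambda_j > - c ([tan_lt_of_sum_atan]).

    It remains to see that F is Hermitian ([curvature_hermitian]). Its entries
    are second Wirtinger derivatives of the real function log h, so this is the
    equality of mixed second partial derivatives ([mixed_derive_sym]), applied
    to the local weight of the metric. *)

Set Implicit Arguments.
Unset Strict Implicit.
Unset Printing Implicit Defensive.

Import Order.TTheory GRing.Theory Num.Theory.
Import numFieldNormedType.Exports.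
Local Open Scope classical_set_scope.
Local Open Scope complex_scope.
Local Open Scope sesquilinear_scope.
Local Open Scope ring_scope.

(** * Symmetry of second derivatives *)

(** A directional derivative is the derivative of the restriction to a line;
    this gives access to the one-variable mean value theorem and chain rule. *)
Lemma is_derive_line (R : realType) (V : normedModType R) (f : V -> R)
    (p v : V) (t df : R) :
  is_derive (t *: v + p) v f df <->
  is_derive t 1 (fun s : R => f (s *: v + p)) df.
Proof.
have E : (fun h : R => h^-1 *: (f (h *: v + (t *: v + p)) - f (t *: v + p)))
    = (fun h : R => h^-1 *: (f ((h *: 1 + t) *: v + p) - f (t *: v + p))).
  by apply/funext => h; rewrite scalerDl /GRing.scale /= mulr1 addrA.
split=> -[fd fE]; split; move: fd fE; rewrite /derivable /derive /=.
- by rewrite E.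
- by rewrite E.
- by rewrite E.
- by rewrite E.
Qed.

(** Two applications of the mean value theorem: the second difference over a
    parallelogram is first the increment in s of g s = f (p + s u + d v)
    - f (p + s u), hence d times g' s = D_u f (p + s u + d v)
    - D_u f (p + s u), which is in turn an increment in the direction v. *)
Lemma second_difference_MVT (R : realType) (V : normedModType R) (f : V -> R)
    (p u v : V) (d : R) :
  0 < d ->
  (forall s t : R, 0 <= s <= d -> 0 <= t <= d ->
     derivable f (s *: u + (t *: v + p)) u /\
     derivable ('D_u f) (s *: u + (t *: v + p)) v) ->
  exists s t : R, [/\ 0 <= s <= d, 0 <= t <= d &
    f (d *: u + (d *: v + p)) - f (d *: u + p) - (f (d *: v + p) - f p)
    = 'D_v ('D_u f) (s *: u + (t *: v + p)) * d * d].
Proof.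
move=> d0 fd.
have dd : 0 <= d <= d by rewrite (ltW d0) lexx.
have d00 : 0 <= (0 : R) <= d by rewrite lexx ltW.
pose g (s : R) := f (s *: u + (d *: v + p)) - f (s *: u + p).
pose dg (s : R) := 'D_u f (s *: u + (d *: v + p)) - 'D_u f (s *: u + p).
have gP s : 0 <= s <= d -> is_derive s 1 g (dg s).
  move=> sd.
  have h1 := proj1 (@is_derive_line R V f (d *: v + p) u s _)
    (derivableP (proj1 (fd s d sd dd))).
  have := proj1 (fd s 0 sd d00); rewrite scale0r add0r => /derivableP.
  move=> /(proj1 (@is_derive_line R V f p u s _)) h2.
  exact: (is_deriveB h1 h2).
have gI x : x \in `]0, d[ -> is_derive x 1 g (dg x).
  by move=> xd; apply: gP; rewrite !ltW ?(itvP xd).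
have gC : {within `[0, d], continuous g}.
  by apply: derivable_within_continuous => x xd; have [] := gP x xd.
have [s sd] := MVT d0 gI gC.
rewrite subr0 {1 2}/g scale0r !add0r => gE.
have {}sd : 0 <= s <= d by rewrite !ltW ?(itvP sd).
pose k (t : R) := 'D_u f (s *: u + (t *: v + p)).
pose dk (t : R) := 'D_v ('D_u f) (s *: u + (t *: v + p)).
have kP t : 0 <= t <= d -> is_derive t 1 k (dk t).
  move=> td; rewrite /k /dk.
  under eq_fun do rewrite addrCA.
  rewrite (addrCA (s *: u)).
  apply: (proj1 (@is_derive_line R V ('D_u f) (s *: u + p) v t _)).
  by apply: derivableP; rewrite (addrCA (t *: v)); case: (fd s t sd td).
have kI x : x \in `]0, d[ -> is_derive x 1 k (dk x).
  by move=> xd; apply: kP; rewrite !ltW ?(itvP xd).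
have kC : {within `[0, d], continuous k}.
  by apply: derivable_within_continuous => x xd; have [] := kP x xd.
have [t td] := MVT d0 kI kC.
rewrite subr0 {1 2}/k scale0r !add0r => kE.
exists s, t; split => //; first by rewrite !ltW ?(itvP td).
by rewrite gE /dg kE.
Qed.

(** The second difference is symmetric in u and v, so both mixed derivatives,
    each taken at some point of an arbitrarily small parallelogram, have the
    same value; continuity at p concludes. *)
Lemma mixed_derive_sym (R : realType) (V : normedModType R) (f : V -> R)
    (p u v : V) :
  (\forall q \near p, [/\ derivable f q u, derivable f q v,
     derivable ('D_u f) q v & derivable ('D_v f) q u]) ->
  {for p, continuous ('D_v ('D_u f))} ->
  {for p, continuous ('D_u ('D_v f))} ->
  'D_v ('D_u f) p = 'D_u ('D_v f) p.
Proof.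
move=> fd cvu cuv; apply/eqP; rewrite -subr_eq0 -normr_le0.
apply/ler_addgt0Pl => e e0; rewrite addr0.
have e2 : 0 < e / 2 by rewrite divr_gt0.
move/cvgrPdist_lt: cvu => /(_ _ e2) cvu; move/cvgrPdist_lt: cuv => /(_ _ e2) cuv.
have := filterI fd (filterI cvu cuv).
rewrite nbhs_ballP => -[r /= r0 rP].
(* The side d is chosen so that d * (`|u| + `|v|) < r, and the 1 in N avoids
   a division by zero when u = v = 0. *)
pose N := `|u| + `|v| + 1.
have N0 : 0 < N by rewrite ltr_wpDl ?addr_ge0.
pose d := r / N / 2.
have d0 : 0 < d by rewrite !divr_gt0.
have box (s t : R) : 0 <= s <= d -> 0 <= t <= d ->
    ball p r (s *: u + (t *: v + p)).
  move=> /andP[s0 sd] /andP[t0 td]; rewrite -ball_normE /= distrC addrA addrK.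
  apply: (le_lt_trans (ler_normD _ _)); rewrite !normrZ !ger0_norm//.
  apply: (@le_lt_trans _ _ (d * N)).
    rewrite /N !mulrDr mulr1 -addrA lerD ?ler_wpM2r//.
    by rewrite ler_wpDr ?(ltW d0) ?ler_wpM2r.
  by rewrite /d mulrAC divfK ?gt_eqF// ltr_pdivrMr// mulr_natr mulr2n ltrDl.
have [s [t [sd td E1]]] : exists s t : R, [/\ 0 <= s <= d, 0 <= t <= d &
    f (d *: u + (d *: v + p)) - f (d *: u + p) - (f (d *: v + p) - f p)
    = 'D_v ('D_u f) (s *: u + (t *: v + p)) * d * d].
  apply: second_difference_MVT => // s t sd td.
  by have [[h1 _ h2 _] _] := rP _ (box s t sd td); exact: (conj h1 h2).
have [t' [s' [td' sd' E2]]] : exists t s : R, [/\ 0 <= t <= d, 0 <= s <= d &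
    f (d *: u + (d *: v + p)) - f (d *: v + p) - (f (d *: u + p) - f p)
    = 'D_u ('D_v f) (s *: u + (t *: v + p)) * d * d].
  have [x y xd yd|x [y [xd yd E2]]] := @second_difference_MVT R V f p v u d d0.
    rewrite (addrCA (x *: v)).
    by have [[_ h1 _ h2] _] := rP _ (box y x yd xd); exact: (conj h1 h2).
  exists x, y; split; [exact: xd|exact: yd|].
  by rewrite (addrCA (y *: u)) -E2 (addrCA (d *: v)).
have E : 'D_v ('D_u f) (s *: u + (t *: v + p)) =
         'D_u ('D_v f) (s' *: u + (t' *: v + p)).
  have dn0 : d != 0 by rewrite gt_eqF.
  apply: (mulIf dn0); apply: (mulIf dn0).
  have swap (a b c k : R) : a - b - (c - k) = a - c - (b - k) by ring.
  exact: etrans (esym E1) (etrans (swap _ _ _ _) E2).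
have [_ [/= A1 _]] := rP _ (box s t sd td).
have [_ [_ /= A2]] := rP _ (box s' t' sd' td').
rewrite -E distrC in A2.
apply: le_trans (ler_distD _ _ _) _; rewrite [e]splitr.
exact: lerD (ltW A1) (ltW A2).
Qed.

Lemma is_derive_ln (R : realType) (V : normedModType R) (f : V -> R)
    (p v : V) (df : R) :
  0 < f p -> is_derive p v f df ->
  is_derive p v (fun q => ln (f q)) (df / f p).
Proof.
move=> fp fd.
have pE : 0 *: v + p = p by rewrite scale0r add0r.
rewrite -[X in is_derive X]pE in fd *; rewrite -[in X in _ / X]pE mulrC.
apply: (proj2 (is_derive_line (fun q => ln (f q)) p v 0 _)).
have fd' := proj1 (is_derive_line f p v 0 _) fd.
have ln' : is_derive (f (0 *: v + p)) 1 (@ln R) (f (0 *: v + p))^-1.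
  by apply: is_derive1_ln; rewrite pE.
exact: (@is_derive1_comp _ _ (fun s : R => f (s *: v + p)) 0 _ _ ln' fd').
Qed.

Lemma smoothOn_mixed (R : realType) (n : nat) (U : set (coordSpace R n))
    (f : coordSpace R n -> R) (d e : 'I_n + 'I_n) (p : coordSpace R n) :
  open U -> smoothOn U f -> U p ->
  partial d (partial e f) p = partial e (partial d f) p.
Proof.
move=> Uo fs Up; apply: mixed_derive_sym.
- apply: filterS (open_nbhs_nbhs (conj Uo Up)) => q Uq.
  have [_ f0] := fs [::] q Uq.
  have [_ fe] := fs [:: e] q Uq; have [_ fd] := fs [:: d] q Uq.
  split; [exact: f0|exact: f0|exact: fe|exact: fd].
- by have [] := fs [:: d; e] p Up.
- by have [] := fs [:: e; d] p Up.
Qed.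

Lemma partial_ln (R : realType) (n : nat) (U : set (coordSpace R n))
    (f : coordSpace R n -> R) (e : 'I_n + 'I_n) (p : coordSpace R n) :
  smoothOn U f -> U p -> 0 < f p ->
  partial e (fun q => ln (f q)) p = partial e f p / f p.
Proof.
move=> fs Up fp; have [_ fd] := fs [::] p Up.
exact: (@derive_val _ _ _ _ _ _ _ (is_derive_ln fp (derivableP (fd e)))).
Qed.

(** The quotient rule for the logarithmic derivative of f. Near p the function
    partial e (ln f) agrees with (partial e f) / f, which is all that its
    derivative at p depends on. *)
Lemma is_derive_partial_ln (R : realType) (n : nat) (U : set (coordSpace R n))
    (f : coordSpace R n -> R) (d e : 'I_n + 'I_n) (p : coordSpace R n) :
  open U -> smoothOn U f -> (forall q, U q -> 0 < f q) -> U p ->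
  is_derive p (realDir R d) (partial e (fun q => ln (f q)))
    (partial d (partial e f) p / f p
     - partial e f p * partial d f p / f p ^+ 2).
Proof.
move=> Uo fs f0 Up.
apply: (@near_eq_is_derive _ _ _ (fun q => partial e f q * (f q)^-1)).
  apply: filterS (open_nbhs_nbhs (conj Uo Up)) => q Uq.
  by rewrite (partial_ln _ fs Uq (f0 _ Uq)).
have fd : derivable f p (realDir R d)
  := proj2 (fs [::] p Up) d.
have fed : derivable (partial e f) p (realDir R d)
  := proj2 (fs [:: e] p Up) d.
have fp0 : f p != 0 by rewrite gt_eqF ?f0.
have fVd := derivableV fp0 fd.
split; first exact: derivableM fed fVd.
rewrite (deriveM fed fVd) (deriveV fp0 fd).
have quot (x y z t : R) : x * (- t ^- 2 * z) + t^-1 * y = y / t - x * z / t ^+ 2.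
  by rewrite mulNr mulrN addrC mulrC [t ^- 2 * z]mulrC mulrA.
exact: quot.
Qed.

Lemma partial_ln_sym (R : realType) (n : nat) (U : set (coordSpace R n))
    (f : coordSpace R n -> R) (d e : 'I_n + 'I_n) (p : coordSpace R n) :
  open U -> smoothOn U f -> (forall q, U q -> 0 < f q) -> U p ->
  partial d (partial e (fun q => ln (f q))) p =
  partial e (partial d (fun q => ln (f q))) p.
Proof.
move=> Uo fs f0 Up.
have de := @derive_val _ _ _ _ _ _ _ (is_derive_partial_ln d e Uo fs f0 Up).
have ed := @derive_val _ _ _ _ _ _ _ (is_derive_partial_ln e d Uo fs f0 Up).
have sym (x y a b t s : R) : x = y -> x / t - a * b / s = y / t - b * a / s.
  by move=> ->; rewrite [a * b]mulrC.
have fde := smoothOn_mixed d e Uo fs Up.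
exact: etrans de (etrans (sym _ _ _ _ _ _ fde) (esym ed)).
Qed.

(** * Hermitian matrices *)

Lemma trmxC_mul (C : numClosedFieldType) (m n p : nat)
    (A : 'M[C]_(m, n)) (B : 'M[C]_(n, p)) :
  (A *m B) ^t* = B ^t* *m A ^t*.
Proof. by rewrite trmx_mul map_mxM. Qed.

Lemma hermsymmxP (C : numClosedFieldType) (n : nat) (A : 'M[C]_n) :
  reflect (A ^t* = A) (A \is hermsymmx).
Proof.
apply: (iffP (is_hermitianmxP _ _ _)); rewrite expr0 scale1r => E.
  by rewrite -E.
by rewrite E.
Qed.

Lemma hermitian_spectral (C : numClosedFieldType) (n : nat) (A : 'M[C]_n) :
  A \is hermsymmx ->
  exists (P : 'M[C]_n) (d : 'rV[C]_n), [/\ P *m P ^t* = 1%:M,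
    forall i, d 0 i \is Num.real & A = P ^t* *m diag_mx d *m P].
Proof.
move=> Ah; exists (spectralmx A), (spectral_diag A); split.
- exact/unitarymxP/spectral_unitarymx.
- by move=> i; have /mxOverP := hermitian_spectral_diag_real Ah; exact.
- rewrite -invmx_unitary ?spectral_unitarymx//.
  exact/orthomx_spectralP/hermitian_normalmx.
Qed.

Lemma diag_form (C : numClosedFieldType) (n : nat) (d : 'rV[C]_n)
    (v : 'cV[C]_n) :
  (v ^t* *m diag_mx d *m v) 0 0 = \sum_i d 0 i * `|v i 0| ^+ 2.
Proof.
rewrite mul_mx_diag !mxE; apply: eq_bigr => i _; rewrite !mxE.
by rewrite normCK mulrAC mulrC [_ * v i 0]mulrC.
Qed.

Lemma posdef_congr (R : realType) (n : nat) (T : 'M[R[i]]_n) (d : 'rV[R[i]]_n) :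
  T \in unitmx -> (forall i, 0 < d 0 i) ->
  posdefmx (T ^t* *m diag_mx d *m T).
Proof.
move=> Tu d0; split.
  have dE : (diag_mx d) ^t* = diag_mx d.
    rewrite tr_diag_mx map_diag_mx; congr diag_mx; apply/rowP => i.
    by rewrite mxE; apply/CrealP/gtr0_real.
  by apply/hermsymmxP; rewrite !trmxC_mul trmxCK mulmxA dE.
move=> v v0.
rewrite !mulmxA -trmxC_mul -2!mulmxA mulmxA diag_form.
have : T *m v != 0.
  by apply: contra_neq v0 => Tv0; rewrite -(mulKmx Tu v) Tv0 mulmx0.
have [i wi0 _|w0] := pickP (fun i => (T *m v) i 0 != 0).
  rewrite (bigD1 i)//= ltr_wpDr//; last first.
    by rewrite mulr_gt0// exprn_gt0// normr_gt0.
  by apply: sumr_ge0 => j _; rewrite mulr_ge0 ?(ltW (d0 j)) ?exprn_ge0.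
case/eqP; apply/colP => i; rewrite [RHS]mxE.
by move: (w0 i) => /negbFE/eqP.
Qed.

(** A spectral decomposition g = P^* diag(d) P has d positive, by testing
    positivity on the columns of P^*; take S = diag(sqrt d) P. *)
Lemma posdef_factor (R : realType) (n : nat) (g : 'M[R[i]]_n) :
  posdefmx g -> exists2 S : 'M[R[i]]_n, S \in unitmx & g = S ^t* *m S.
Proof.
move=> [gh g0]; have [P [d [PU _ gE]]] := hermitian_spectral gh.
have d0 i : 0 < d 0 i.
  have ei0 : P ^t* *m delta_mx i 0 != 0 :> 'cV_n.
    apply/eqP => /(congr1 (mulmx P)); rewrite mulmx0 mulmxA PU mul1mx.
    by move/colP/(_ i)/eqP; rewrite !mxE !eqxx oner_eq0.
  have := g0 _ ei0; rewrite gE trmxC_mul trmxCK !mulmxA.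
  rewrite -[_ *m P *m _]mulmxA PU mulmx1 -[_ *m P *m _]mulmxA PU mulmx1.
  rewrite diag_form (bigD1 i)//= big1 => [|j ji]; last first.
    by rewrite mxE (negPf ji) normr0 expr0n mulr0.
  by rewrite addr0 mxE !eqxx normr1 expr1n mulr1.
pose s : 'rV[R[i]]_n := \row_i sqrtC (d 0 i).
have Pu : P \in unitmx by case/mulmx1_unit: PU.
exists (diag_mx s *m P).
  rewrite unitmx_mul Pu andbT unitmxE det_diag unitfE prodf_seq_neq0.
  by apply/allP => i _; rewrite mxE sqrtC_eq0 gt_eqF.
have sE : (diag_mx s) ^t* *m diag_mx s = diag_mx d.
  rewrite tr_diag_mx map_diag_mx mulmx_diag; congr diag_mx; apply/rowP => i.
  rewrite !mxE; have /= -> : (sqrtC (d 0 i))^* = sqrtC (d 0 i).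
    by apply/CrealP; rewrite ger0_real// sqrtC_ge0 ltW.
  by rewrite -expr2 sqrtCK.
by rewrite gE trmxC_mul mulmxA -(mulmxA _ _ (diag_mx s)) sE.
Qed.

(** With g = S^* S, the matrix S^-* F S^-1 is still Hermitian; diagonalizing it
    by a unitary P, one takes T = P S, for which T^* T = S^* S = g. *)
Lemma simultaneous_diag (R : realType) (n : nat) (g F : 'M[R[i]]_n) :
  posdefmx g -> F \is hermsymmx ->
  exists (T : 'M[R[i]]_n) (d : 'rV[R[i]]_n), [/\ T \in unitmx,
    forall i, d 0 i \is Num.real, g = T ^t* *m T &
    F = T ^t* *m diag_mx d *m T].
Proof.
move=> /posdef_factor[S Su gE] /hermsymmxP Fh.
pose M := (invmx S) ^t* *m F *m invmx S.
have Mh : M \is hermsymmx.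
  by apply/hermsymmxP; rewrite /M !trmxC_mul trmxCK Fh mulmxA.
have [P [d [PU dr ME]]] := hermitian_spectral Mh.
have SVS : S ^t* *m (invmx S) ^t* = 1%:M.
  by rewrite -trmxC_mul mulVmx// trmx1 map_mx1.
have Pu : P \in unitmx by case/mulmx1_unit: PU.
exists (P *m S), d; split => //; first by rewrite unitmx_mul Pu.
  by rewrite trmxC_mul mulmxA -[_ *m P]mulmxA (mulmx1C PU) mulmx1.
rewrite trmxC_mul.
have -> : F = S ^t* *m M *m S.
  by rewrite /M !mulmxA SVS mul1mx mulmxKV.
by rewrite ME !mulmxA.
Qed.

Lemma mem_eigenvals (R : realType) (n : nat) (K : 'M[R[i]]_n) (a : R[i]) :
  (a \in eigenvals K) = eigenvalue K a.
Proof.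
rewrite eigenvalue_root_char /eigenvals.
case: closed_field_poly_normal => /= r ->.
by rewrite (monicP (char_poly_monic K)) scale1r root_prod_XsubC.
Qed.

Lemma size_eigenvals (R : realType) (n : nat) (K : 'M[R[i]]_n) :
  size (eigenvals K) = n.
Proof.
rewrite /eigenvals; case: closed_field_poly_normal => /= r.
rewrite (monicP (char_poly_monic K)) scale1r.
move=> /(congr1 (fun p => size (polyseq p))).
by rewrite size_char_poly size_prod_XsubC => -[].
Qed.

(** In the simultaneous diagonalization g^-1 F = T^-1 diag(d) T, the row of index
    i of T is a left eigenvector of eigenvalue d_i, while c g + F =
    T^* diag(c + d) T. *)
Lemma posdef_shift (R : realType) (n : nat) (g F : 'M[R[i]]_n) (c : R) :
  posdefmx g -> F \is hermsymmx ->
  (forall a, a \in eigenvals (invmx g *m F) -> 0 < c + complex.Re a) ->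
  posdefmx (c%:C%C *: g + F).
Proof.
move=> gp Fh aP; have [T [d [Tu dr gE FE]]] := simultaneous_diag gp Fh.
have -> : c%:C%C *: g + F = T ^t* *m diag_mx (const_mx c%:C%C + d) *m T.
  rewrite raddfD /= diag_const_mx mulmxDr mulmxDl -FE mul_mx_scalar.
  by rewrite -scalemxAl -gE.
apply: posdef_congr => // i; rewrite !mxE.
have TVu : T ^t* \in unitmx by rewrite map_unitmx unitmx_tr.
have : d 0 i \in eigenvals (invmx g *m F).
  rewrite mem_eigenvals; apply/eigenvalueP; exists (row i T); last first.
    apply/eqP => /(congr1 (mulmx^~ (invmx T))).
    rewrite mul0mx -row_mul mulmxV// row1 => /rowP/(_ i)/eqP.
    by rewrite !mxE !eqxx oner_eq0.
  have -> : invmx g *m F = invmx T *m diag_mx d *m T.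
    have gu : g \in unitmx by rewrite gE unitmx_mul TVu.
    have {1}-> : F = g *m (invmx T *m diag_mx d *m T).
      by rewrite gE FE !mulmxA mulmxK.
    exact: mulKmx.
  rewrite !mulmxA -[row i T *m _]row_mul mulmxV// row1.
  by rewrite -rowE row_diag_mx -scalemxAl -rowE.
move/aP => cd0.
have dE : d 0 i = (complex.Re (d 0 i))%:C%C.
  by rewrite RRe_real// dr.
by rewrite dE -rmorphD /= ltcR.
Qed.

(** * Curvature is Hermitian *)

Lemma dz_rect (R : realType) (n : nat) (j : 'I_n)
    (A B : coordSpace R n -> R) (p : coordSpace R n) :
  dz j (fun q => A q +i* B q) p =
    (2^-1 * (partial (inl j) A p + partial (inr j) B p)) +i*
    (2^-1 * (partial (inl j) B p - partial (inr j) A p)).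
Proof.
have E (x y z t : R) : (x +i* y - 'i * (z +i* t)) / 2 =
    (2^-1 * (x + t)) +i* (2^-1 * (y - z)).
  have -> : 2 = 2%:R%:C :> R[i] by rewrite rmorph_nat.
  rewrite -fmorphV; apply/eqP; rewrite eq_complex /=.
  by apply/andP; split; apply/eqP; ring.
exact: E.
Qed.

Lemma dzbar_real (R : realType) (n : nat) (k : 'I_n)
    (u : coordSpace R n -> R) :
  dzbar k (fun q => (u q)%:C) =
    (fun q => (2^-1 * partial (inl k) u q) +i* (2^-1 * partial (inr k) u q)).
Proof.
have E (x y : R) : (x +i* 0 + 'i * (y +i* 0)) / 2 =
    (2^-1 * x) +i* (2^-1 * y).
  have -> : 2 = 2%:R%:C :> R[i] by rewrite rmorph_nat.
  rewrite -fmorphV; apply/eqP; rewrite eq_complex /=.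
  by apply/andP; split; apply/eqP; ring.
have E0 (x y z t : R) : z = 0 -> t = 0 -> (x +i* z + 'i * (y +i* t)) / 2 =
    (2^-1 * x) +i* (2^-1 * y).
  by move=> -> ->.
have d0 d (q : coordSpace R n) : partial d (fun=> 0) q = 0.
  exact: derive_cst.
apply/funext => q; exact: E0 (d0 (inl k) q) (d0 (inr k) q).
Qed.

Lemma dz_dzbar_real (R : realType) (n : nat) (j k : 'I_n)
    (u : coordSpace R n -> R) (p : coordSpace R n) :
  (forall d e, derivable (partial e u) p (realDir R d)) ->
  dz j (dzbar k (fun q => (u q)%:C)) p =
    ((partial (inl j) (partial (inl k) u) p
      + partial (inr j) (partial (inr k) u) p) / 4%:R) +i*
    ((partial (inl j) (partial (inr k) u) p
      - partial (inr j) (partial (inl k) u) p) / 4%:R).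
Proof.
move=> ud.
have half d e : partial d (fun q => 2^-1 * partial e u q) p =
    2^-1 * partial d (partial e u) p.
  exact: (deriveZ (2^-1 : R) (ud d e)).
have E (a b c e x y z t : R) :
    a = 2^-1 * x -> b = 2^-1 * y -> c = 2^-1 * z -> e = 2^-1 * t ->
    (2^-1 * (a + b)) +i* (2^-1 * (c - e)) =
    ((x + y) / 4%:R) +i* ((z - t) / 4%:R).
  by move=> -> -> -> ->; congr (_ +i* _); field.
rewrite dzbar_real dz_rect.
exact: E (half _ _) (half _ _) (half _ _) (half _ _).
Qed.

Lemma chart_trivialization_open (R : realType) (n : nat) (X : complexManifold R n)
    (a : chartIdx X) (D : set X) :
  open D -> open [set p | chartImg a p /\ D (param a p)].
Proof.
move=> Do; rewrite openE => p [ap Dp].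
have := param_continuous ap (open_nbhs_nbhs (conj Do Dp)).
exact: filterI (open_nbhs_nbhs (conj (@chartImg_open _ _ X a) ap)).
Qed.

(** Conjugating d_j d_kbar u for a real u exchanges j and k up to the order of
    the real partial derivatives, as the formula of [dz_dzbar_real] shows. *)
Lemma curvature_hermitian (R : realType) (n : nat) (X : complexManifold R n)
    (L : lineBundle X) (h : hermitianMetric L) (a : chartIdx X)
    (p : coordSpace R n) :
  chartImg a p -> curvature h a p \is hermsymmx.
Proof.
move=> ap; set i0 := trivAt L (param a p).
pose U := [set q | chartImg a q /\ trivDom i0 (param a q)].
have Uo : open U by apply: chart_trivialization_open; exact: trivDom_open.
have Up : U p by split => //; exact: trivAt_in.
pose f q := weight h i0 (param a q).
have fs : smoothOn U f by exact: weight_smooth.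
have f0 q : U q -> 0 < f q by case=> _; exact: weight_gt0.
pose u q := ln (f q).
have uP d e := is_derive_partial_ln d e Uo fs f0 Up.
have ud d e : derivable (partial e u) p (realDir R d) by case: (uP d e).
have uC d e := partial_ln_sym d e Uo fs f0 Up.
apply/hermsymmxP/matrixP => k j; rewrite !mxE /=.
rewrite (dz_dzbar_real k j ud) (dz_dzbar_real j k ud).
have E (a1 a2 b1 b2 c1 c2 e1 e2 : R) :
    a1 = a2 -> b1 = b2 -> c1 = e2 -> e1 = c2 ->
    (- (((a1 + b1) / 4%:R) +i* ((c1 - e1) / 4%:R)))^* =
    - (((a2 + b2) / 4%:R) +i* ((c2 - e2) / 4%:R)) :> R[i].
  move=> -> -> -> ->; apply/eqP; rewrite eq_complex /= eqxx /=.
  by apply/eqP; ring.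
exact: E (uC _ _) (uC _ _) (uC _ _) (uC _ _).
Qed.

(** * The phase inequality *)

(** All the other terms being less than pi / 2, the term atan x must exceed
    t - (size s - 1) pi / 2. There have to be other terms for this inequality
    to be strict, whence the bound on the size. *)
Lemma tan_lt_of_sum_atan (R : realType) (s : seq R) (x t : R) :
  (2 <= size s)%N -> x \in s -> \sum_(y <- s) atan y = t ->
  ((size s)%:R - 2) * (pi / 2) < t ->
  tan (t - ((size s)%:R - 1) * (pi / 2)) < x.
Proof.
move=> s2 xs st slt.
have rest (r : seq R) : r != [::] ->
    \sum_(y <- r) atan y < (size r)%:R * (pi / 2).
  case: r => // z r _; elim: r z => [|y r IH] z.
    by rewrite big_seq1 mul1r atan_ltpi2.
  rewrite big_cons [size _]/= -natr1 mulrDl mul1r addrC.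
  by apply: ltrD; [exact: IH|exact: atan_ltpi2].
have szr : size (rem x s) = (size s).-1 by rewrite size_rem.
have : \sum_(y <- rem x s) atan y < ((size s)%:R - 1) * (pi / 2).
  have -> : (size s)%:R - 1 = (size (rem x s))%:R :> R.
    by rewrite szr -subn1 natrB// (leq_trans _ s2).
  by apply: rest; rewrite -size_eq0 szr; case: (size s) s2 => [|[]].
move: st; rewrite (perm_big _ (perm_to_rem xs)) big_cons => st restlt.
set b := t - _.
have b1 : b < atan x by rewrite /b -st ltrBlDr ltrD2l.
rewrite -[x]atanK ltr_tan//.
  rewrite in_itv /= (lt_trans b1 (atan_ltpi2 x)) andbT /b.
  by move: slt; lra.
by rewrite in_itv /= atan_gtNpi2 atan_ltpi2.
Qed.

Unset Implicit Arguments.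

(* Z_L does not depend on the metric; it is computed with the metric h0. *)
Theorem mainTheorem5 (R : realType) (n : nat) (hn : (3 <= n)%N)
    (X : complexManifold R n)
    (Xcompact : compact [set: X]) (Xconnected : connected [set: X])
    (w : kahlerForm X) (wvol : topPowerInt (kcoeff w) = 1)
    (L : lineBundle X) (h0 : hermitianMetric L)
    (thetahat : R)
    (ZL_neq0 : chargeZ w h0 != 0) (argZL : isArg (chargeZ w h0) thetahat)
    (thetahat_ge0 : 0 <= thetahat)
    (supercritical : (n%:R - 2) * (pi / 2) < thetahat) :
  (exists h : hermitianMetric L,
     forall (a : chartIdx X) (p : coordSpace R n),
       chartImg a p -> theta w h a p = thetahat) ->
  stable w L thetahat.
Proof.
move=> [h hE]; exists h => a p ap.
apply: posdef_shift; [exact: kahler_positive|exact: curvature_hermitian|].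
move=> lam; rewrite -/(curvEndo w h a p) => lamK.
pose s := [seq complex.Re z | z <- eigenvals (curvEndo w h a p)].
have sn : size s = n by rewrite size_map size_eigenvals.
rewrite addrC subr_gt0 -sn.
apply: (@tan_lt_of_sum_atan _ s).
- by rewrite sn ltnW.
- exact: map_f.
- by rewrite big_map; exact: hE.
- by rewrite sn.
Qed.
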